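(* Let $k\in[0,1]$ and $n_k=\lfloor k\Lambda(\tau)\rfloor$. Under batch processing, the inspector selects at time $\tau$ the $n_k$ transactions with the largest scores among all $N(\tau)$ arrivals. Let $N_0(\tau)$, $N_1(\tau)$ be the numbers of non-fraudulent and fraudulent arrivals, let $S^{(0)}_{(1)}\le\dots\le S^{(0)}_{(N_0(\tau))}$ and $S^{(1)}_{(1)}\le\dots\le S^{(1)}_{(N_1(\tau))}$ be the order statistics of their scores, and set $\rho_0(j)=N_0(\tau)-n_k+j$, $\rho_1(j)=N_1(\tau)-j+1$. For $j=1,\dots,\min\{n_k,N_1(\tau)\}$ define $$F_{W_j}(w)=\int_0^1\int_0^{w+s_1} f_{S^{(0)}_{(\rho_0(j))}}(s_0)\,f_{S^{(1)}_{(\rho_1(j))}}(s_1)\,ds_0\,ds_1,$$ the CDF of $W_j=S^{(0)}_{(\rho_0(j))}-S^{(1)}_{(\rho_1(j))}$, where the order-statistic densities are, for an i.i.d. sample of size $n$ with CDF $F$ and density $f$, $f_{(i)}(x)=i\binom{n}{i}F(x)^{i-1}(1-F(x))^{n-i}f(x)$ (with $(F,f,n)=(F_0,f_0,N_0(\tau))$ for $S^{(0)}$ and $(F_1,f_1,N_1(\tau))$ for $S^{(1)}$). Then the fraud detection rate $\Psi_{BP}(k)$ of batch processing satisfies $$\Psi_{BP}(k)\ \ge\ \frac{1}{\beta\Lambda(\tau)}\,\mathbb{E}_{N_0,N_1}\Big[\sum_{j=1}^{\min\{n_k,N_1(\tau)\}}F_{W_j}(0)\Big].$$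
   Context: Setting: transactions arrive on $[0,\tau]$ according to an NHPP $N(t)$ with continuous intensity $\lambda(t)$, $\Lambda(t)=\int_0^t\lambda(u)du$. Each transaction has label $Y\in\{0,1\}$ with $P(Y=1)=\beta\ll1/2$ and classifier score $S\in[0,1]$; transactions are independent, and scores/labels are independent of arrival times. By thinning, fraudulent and non-fraudulent arrivals form independent NHPPs $N_1(t)$, $N_0(t)$ with intensities $\beta\lambda(t)$, $(1-\beta)\lambda(t)$. $F_0,f_0$ (resp. $F_1,f_1$) are the CDF and density of the score of a non-fraudulent (resp. fraudulent) transaction. With capacity $k$, at most $n_k=\lfloor k\Lambda(\tau)\rfloor$ transactions are inspected. The fraud detection rate $\Psi(k)$ is the expected fraction of all fraudulent transactions arriving in $[0,\tau]$ that are inspected, $\Psi(k)=\mathbb{E}\big[\sum_{i\in\mathcal{I}(k)}Y_i/\sum_{i=1}^{N(\tau)}Y_i\big]$ (ratio taken as $1$ if no fraud arrives). *)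

(* Defs.v *)
From HB Require Import structures.
From mathcomp Require Import all_boot all_order all_algebra.
From mathcomp Require Import all_classical all_reals all_analysis.
Set Implicit Arguments. Unset Strict Implicit. Unset Printing Implicit Defensive.
Import Order.TTheory GRing.Theory Num.Theory.
Import numFieldNormedType.Exports.
Local Open Scope classical_set_scope.
Local Open Scope ring_scope.

Section Defs.
Variable R : realType.
Notation leb := (@lebesgue_measure R).

Definition pr d (T : measurableType d) (P : probability T R) (A : set T) : R :=
  fine (P A).

Definition poisson_mass (m : R) (n : nat) : R :=
  expR (- m) * m ^+ n / (n`!)%:R.

Definition cum_intensity (lam : R -> R) (t : R) : R :=
  \int[leb]_(u in `[0, t]) lam u.

Definition capacity_nk (k Lam : R) : nat := Num.truncn (k * Lam).

Definition score_cdf (f : R -> R) (x : R) : R :=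
  \int[leb]_(u in `[0, 1] `&` [set u | u <= x]) f u.

Definition os_density (F f : R -> R) (n i : nat) (x : R) : R :=
  i%:R * ('C(n, i))%:R * F x ^+ i.-1 * (1 - F x) ^+ (n - i) * f x.

(* rho_0(j) = N0 - n_k + j  (as a natural number; when it would be <= 0
   the density above is identically 0, as for the literal formula) and
   rho_1(j) = N1 - j + 1 *)
Definition rho0 (n0 nk j : nat) : nat := (n0 + j - nk)%N.
Definition rho1 (n1 j : nat) : nat := (n1 - j).+1%N.

Definition FW (f0 f1 : R -> R) (nk n0 n1 j : nat) (w : R) : R :=
  \int[leb]_(s1 in `[0, 1])
     ((\int[leb]_(s0 in `[0, w + s1])
          os_density (score_cdf f0) f0 n0 (rho0 n0 nk j) s0)
      * os_density (score_cdf f1) f1 n1 (rho1 n1 j) s1).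

Definition FW_sum (f0 f1 : R -> R) (nk n0 n1 : nat) : R :=
  \sum_(1 <= j < (minn nk n1).+1) FW f0 f1 nk n0 n1 j 0.

(* Batch processing at time tau: all N0 + N1 arrivals are ranked by score
   (ties broken first in favour of non-fraudulent, then by index; ties have
   probability 0), and the n_k highest are inspected.  Fraudulent arrival j
   is inspected iff fewer than n_k arrivals are ranked ahead of it. *)
Definition bp_rank (S0 S1 : nat -> R) (n0 n1 j : nat) : nat :=
  (#|[set i : 'I_n0 | (S1 j <= S0 i)%R]| +
   #|[set j' : 'I_n1 | (S1 j < S1 j')%R || ((S1 j' == S1 j) && (j' < j)%N)]|)%N.

Definition bp_detected (S0 S1 : nat -> R) (nk n0 n1 : nat) : nat :=
  #|[set j : 'I_n1 | (bp_rank S0 S1 n0 n1 j < nk)%N]|.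

Definition bp_ratio (S0 S1 : nat -> R) (nk n0 n1 : nat) : R :=
  if n1 == 0%N then 1 else (bp_detected S0 S1 nk n0 n1)%:R / n1%:R.

End Defs.

(* Main.v *)
Require Import Defs.
From HB Require Import structures.
From mathcomp Require Import all_boot all_order all_algebra.
From mathcomp Require Import all_classical all_reals all_analysis.
From mathcomp Require Import measurable_realfun zify ring lra.
Import Order.TTheory GRing.Theory Num.Theory.
Import numFieldNormedType.Exports.
Local Open Scope classical_set_scope.
Local Open Scope ring_scope.

(* Given the counts [n0] and [n1], a fraudulent arrival with score [s] is
   inspected as soon as fewer than [n_k] of the other scores exceed [s]; let
   [D (n0, n1)] be the probability of this, a sum of products of binomial terms
   in [F0 s] and [F1 s] integrated against [f1].  The order-statistic densities
   are, up to the density factor, derivatives of binomial tails, so the inner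
   integral in [F_{W_j}] is a binomial tail and [sum_j F_{W_j}(0)] is at most
   [n1 * D (n0, n1)], while the expected detected fraction given the counts is
   at least [D (n0, n1)].  Since [D] is nonincreasing in [n1] and
   [n * p n = m * p (n - 1)] for the Poisson weights of mean
   [m = beta * Lambda(tau)],
   [E[N1 * D (N0, N1)] = m * E[D (N0, N1 + 1)] <= m * E[D (N0, N1)]]. *)

(** * Comparing an integral with the increments of a function *)

(** Supremum argument: let [c] be the supremum of the points of [[a, s]] at which [G] is at least
    [G a]. Local comparison across [c] carries the bound from such a point just left of [c] to
    [c + e / 2], or to [s] if that comes first, so [c] cannot stop short of [s]. *)
Lemma locally_le_homo (R : realType) (G : R -> R) (a s : R) : a <= s ->
  (forall x, a <= x <= s -> exists2 e, 0 < e & forall u v,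
     a <= u -> u <= x -> x <= v -> v <= s -> x - e < u -> v < x + e ->
     G u <= G v) ->
  G a <= G s.
Proof.
move=> as_ loc; pose A := [set x | a <= x <= s /\ G a <= G x].
have Aa : A a by split; rewrite ?lexx.
have supA : has_sup A by split; [exists a | exists s => x [/andP[]]].
set c := sup A.
have ac : a <= c by apply: ub_le_sup => //; exact: supA.2.
have cs : c <= s by apply: ge_sup; [exists a | move=> x [/andP[]]].
have [e e0 He] := loc c (introT andP (conj ac cs)).
have [x [/andP[ax xs] Gax] cex] := sup_adherent e0 supA.
have xc : x <= c by apply: ub_le_sup; [exact: supA.2 | split; rewrite ?ax].
have [sce|ces] := leP s (c + e / 2).
  by apply: (le_trans Gax); apply: He => //; lra.
have : c + e / 2 <= c.
  apply: ub_le_sup; first exact: supA.2.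
  split; first by apply/andP; split; lra.
  by apply: (le_trans Gax); apply: He => //; lra.
lra.
Qed.

Lemma within_itv_dist (R : realType) (H : R -> R) (a b : R) :
  {within `[a, b], continuous H} -> forall x, a <= x <= b -> forall e, 0 < e ->
  exists2 r, 0 < r &
    forall y, a <= y <= b -> x - r < y < x + r -> `|H x - H y| < e.
Proof.
move=> cH x xab e e0.
have [_/posnumP[r] /= Hr] : \forall y \near x, y \in `[a, b] -> `|H x - H y| < e.
  have /subspace_continuousP/(_ x) := cH; rewrite /= in_itv/= => /(_ xab).
  by move=> /cvgrPdist_lt/(_ e e0).
exists r%:num => // y yab xry; apply: Hr; last by rewrite in_itv.
by rewrite /ball/= distrC ltr_distl.
Qed.

Lemma integrable_within_continuousM (R : realType) (f H : R -> R) (a b : R) :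
  {within `[a, b], continuous H} ->
  (@lebesgue_measure R).-integrable `[a, b] (EFin \o f) ->
  (@lebesgue_measure R).-integrable `[a, b] (EFin \o (fun x => H x * f x)).
Proof.
move=> cH fi.
have mab : measurable (`[a, b] : set R) by exact: measurable_itv.
apply: (@integrableMr _ _ _ (@lebesgue_measure R) _ mab H (EFin \o f)) => //.
  exact: subspace_continuous_measurable_fun.
have /compact_bounded[M [Mr HM]] : compact (H @` `[a, b]).
  by apply: continuous_compact => //; exact: segment_compact.
by exists M; split => // y My x abx; apply: HM => //; exists x.
Qed.

(* [H] times the [f]-mass of a short interval is bounded by the increment of
   [Phi]; on such an interval the integral of [H * f] differs from that product
   by at most [e] times the mass, so [Phi + e \int f - \int H f] is
   nondecreasing for every [e > 0]. *)
Lemma Rintegral_le_increment (R : realType) (f H Phi : R -> R) (a b : R) :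
  (forall x, a <= x <= b -> 0 <= f x) ->
  (@lebesgue_measure R).-integrable `[a, b] (EFin \o f) ->
  {within `[a, b], continuous H} ->
  (forall u v, a <= u -> u <= v -> v <= b -> exists2 xi, u <= xi <= v &
     H xi * (\int[@lebesgue_measure R]_(x in `]u, v]) f x) <= Phi v - Phi u) ->
  forall s, a <= s <= b ->
  \int[@lebesgue_measure R]_(x in `[a, s]) (H x * f x) <= Phi s - Phi a.
Proof.
move=> f0 fi cH loc s /andP[as_ sb].
pose mu := @lebesgue_measure R.
have Hfi := integrable_within_continuousM _ _ _ _ _ cH fi.
have subl v : v <= b -> `[a, v] `<=` `[a, b].
  by move=> vb; apply: subset_itvl; rewrite bnd_simp.
have subr u v : a <= u -> v <= b -> `]u, v] `<=` `[a, b].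
  move=> au vb x /=; rewrite !in_itv/= => /andP[ux xv].
  by rewrite (le_trans au (ltW ux)) (le_trans xv).
have split_int g u v : mu.-integrable `[a, b] (EFin \o g) ->
    a <= u -> u <= v -> v <= b ->
    \int[mu]_(x in `[a, v]) g x =
    \int[mu]_(x in `[a, u]) g x + \int[mu]_(x in `]u, v]) g x.
  move=> gi au uv vb.
  rewrite -(@Rintegral_itvB _ g (BLeft a) (BRight v) u) ?bnd_simp//.
    by rewrite addrC subrK.
  by apply: integrableS gi => //; exact: subl.
have key e : 0 < e -> \int[mu]_(x in `[a, s]) (H x * f x) <=
    Phi s - Phi a + e * \int[mu]_(x in `[a, s]) f x.
  move=> e0.
  pose G v := Phi v + e * \int[mu]_(x in `[a, v]) f x
              - \int[mu]_(x in `[a, v]) (H x * f x).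
  suff : G a <= G s.
    rewrite /G set_itv1 !Rintegral_set1 mulr0 addr0 subr0; lra.
  apply: locally_le_homo => // x /andP[ax xs].
  (* One half of [e] for [xi] and one for a point [y] of []u, v]], both compared with the centre
     [x]; together they give [H y <= H xi + e]. *)
  have e2 : 0 < e / 2 by lra.
  have axb : a <= x <= b by rewrite ax (le_trans xs).
  have [r r0 Hr] := within_itv_dist _ _ _ _ cH _ axb _ e2.
  exists r => // u v au ux xv vs ru vr.
  have uv := le_trans ux xv; have vb := le_trans vs sb.
  have [xi /andP[uxi xiv] Hxi] := loc u v au uv vb.
  rewrite /G (split_int f u v)// (split_int (fun x => H x * f x) u v)//.
  suff : \int[mu]_(x in `]u, v]) (H x * f x) <=
      (H xi + e) * \int[mu]_(x in `]u, v]) f x by lra.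
  rewrite -RintegralZl//; last by apply: integrableS fi => //; exact: subr.
  apply: le_Rintegral => //.
  - by apply: integrableS Hfi => //; exact: subr.
  - have cc : {within `[a, b], continuous (cst (H xi + e) : R -> R)}.
      by apply: continuous_subspaceT => y; exact: cvg_cst.
    have := integrable_within_continuousM _ _ _ _ _ cc fi.
    by apply: integrableS => //; exact: subr.
  - move=> y; rewrite /= in_itv/= => /andP[uy yv].
    have yab : a <= y <= b by apply/andP; split; lra.
    rewrite ler_wpM2r ?f0//.
    have := Hr y yab; have := Hr xi; rewrite !ltr_distl => h2 h1.
    have /h1/andP[? ?] : x - r < y < x + r by apply/andP; split; lra.
    have /h2/(_ _)/andP[] : a <= xi <= b by apply/andP; split; lra.
      by apply/andP; split; lra.
    lra.
have M0 : 0 <= \int[mu]_(x in `[a, s]) f x.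
  apply: Rintegral_ge0 => x; rewrite /= in_itv/= => /andP[ax xs].
  by apply: f0; rewrite ax (le_trans xs).
apply/ler_addgt0Pr => e e0.
pose M := \int[mu]_(x in `[a, s]) f x.
(* Dividing by [M + 1] rather than [M] allows for zero mass and still keeps the error term at most
   [e]. *)
have eM : 0 < e / (M + 1) by rewrite divr_gt0// ltr_wpDl.
apply: (le_trans (key _ eM)); rewrite lerD2l -/M mulrAC ler_pdivrMr ?ltr_wpDl//.
by rewrite mulrDr mulr1 lerDl ltW.
Qed.

(** * Binomial probabilities as polynomials *)

(** Probability of exactly [a] exceedances among [n] independent scores, as a polynomial in the
    probability ['X] that one score stays below the threshold; formal derivatives are then
    available. *)
Definition binom_term (R : realType) (n a : nat) : {poly R} :=
  'C(n, a)%:R *: ((1 - 'X) ^+ a * 'X ^+ (n - a)).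

(* At [x], the probability that fewer than [c] of [n] independent scores exceed
   a threshold that each of them stays below with probability [x]. *)
Definition binom_tail (R : realType) (n c : nat) : {poly R} :=
  \sum_(a < c) binom_term R n a.

(** The derivative telescopes: the negative part of the derivative of the term of index [c] cancels
    the induction hypothesis, and [(n - c) * 'C(n, c) = c.+1 * 'C(n, c.+1)] puts what remains in the
    required form. *)
Lemma binom_tail_deriv (R : realType) (n c : nat) :
  (binom_tail R n c)^`() =
  (c * 'C(n, c))%:R *: ((1 - 'X) ^+ c.-1 * 'X ^+ (n - c)).
Proof.
elim: c => [|c IH]; first by rewrite /binom_tail big_ord0 deriv0 mul0n scale0r.
have -> : (c.+1 * 'C(n, c.+1))%:R = (n - c)%:R * 'C(n, c)%:R :> R.
  by rewrite mul_bin_left natrM.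
have IH' : (binom_tail R n c)^`() = (c%:R * 'C(n, c)%:R : R) *:
    ((1 - 'X) ^+ c.-1 * 'X ^+ (n - c)) by rewrite IH natrM.
have -> : binom_tail R n c.+1 = binom_tail R n c + binom_term R n c.
  by rewrite /binom_tail big_ord_recr.
have dY : (1 - 'X : {poly R})^`() = -1.
  by rewrite derivB derivX (_ : 1 = 1%:P)// derivC sub0r.
have dT : (binom_term R n c)^`() = 'C(n, c)%:R *:
    (c%:R *: - (1 - 'X) ^+ c.-1 * 'X ^+ (n - c)
     + (1 - 'X) ^+ c * ((n - c)%:R *: 'X ^+ (n - c).-1)).
  rewrite derivZ derivM !deriv_exp dY derivX mul1r mulN1r.
  by congr (_ *: _); rewrite !scaler_nat.
rewrite derivD IH' dT subnS /=.
move: ('C(n, c)%:R : R) (_ ^+ c.-1) (_ ^+ c) (_ ^+ (n - c)) (_ ^+ (n - c).-1).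
move: (c%:R : R) ((n - c)%:R : R) => a b C Y Z U V.
rewrite -!mul_polyC !polyCM; ring.
Qed.

(** * Score distribution functions and order-statistic densities *)

Lemma score_cdfE (R : realType) (f : R -> R) (s : R) : 0 <= s <= 1 ->
  score_cdf f s = \int[@lebesgue_measure R]_(x in `[0, s]) f x.
Proof.
move=> /andP[s0 s1]; congr Rintegral; apply/seteqP; split => x /=.
  by rewrite !in_itv/= => -[/andP[-> _] ->].
by rewrite !in_itv/= => /andP[-> xs]; rewrite (le_trans xs).
Qed.

Lemma score_cdf0 (R : realType) (f : R -> R) : score_cdf f 0 = 0.
Proof. by rewrite score_cdfE ?lexx ?ler01// set_itv1 Rintegral_set1. Qed.

Lemma score_cdf_increment (R : realType) (f : R -> R) (u v : R) :
  (@lebesgue_measure R).-integrable `[0, 1] (EFin \o f) ->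
  0 <= u -> u <= v -> v <= 1 ->
  score_cdf f v - score_cdf f u = \int[@lebesgue_measure R]_(x in `]u, v]) f x.
Proof.
move=> fi u0 uv v1.
rewrite !score_cdfE; [|apply/andP; split; lra..].
rewrite Rintegral_itvB ?bnd_simp//.
by apply: integrableS fi => //; apply: subset_itvl; rewrite bnd_simp.
Qed.

Lemma score_cdf_le (R : realType) (f : R -> R) (u v : R) :
  (forall x, 0 <= x <= 1 -> 0 <= f x) ->
  (@lebesgue_measure R).-integrable `[0, 1] (EFin \o f) ->
  0 <= u -> u <= v -> v <= 1 -> score_cdf f u <= score_cdf f v.
Proof.
move=> f0 fi u0 uv v1; rewrite -subr_ge0 score_cdf_increment//.
apply: Rintegral_ge0 => x; rewrite /= in_itv/= => /andP[ux xv].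
by apply: f0; apply/andP; split; lra.
Qed.

Lemma score_cdf_continuous (R : realType) (f : R -> R) :
  (@lebesgue_measure R).-integrable `[0, 1] (EFin \o f) ->
  {within `[0, 1], continuous (score_cdf f)}.
Proof.
move=> fi; have := @parameterized_integral_continuous _ 0 1 f ler01 fi.
apply: subspace_eq_continuous => x; rewrite inE/= in_itv/= => x01.
by rewrite /from_subspace/= /parameterized_integral score_cdfE.
Qed.

Lemma horner_score_cdf_continuous (R : realType) (f : R -> R) (p : {poly R}) :
  (@lebesgue_measure R).-integrable `[0, 1] (EFin \o f) ->
  {within `[0, 1], continuous (fun x => p.[score_cdf f x])}.
Proof.
move=> fi x; apply: (@continuous_comp _ _ _ (score_cdf f : subspace _ -> _)).
  exact: score_cdf_continuous.
exact: continuous_horner.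
Qed.

Section density.
Variables (R : realType) (f : R -> R).
Hypothesis f_ge0 : forall x, 0 <= x <= 1 -> 0 <= f x.
Hypothesis f_int : (@lebesgue_measure R).-integrable `[0, 1] (EFin \o f).
Local Notation F := (score_cdf f).

Lemma score_cdf_ge0 x : 0 <= x <= 1 -> 0 <= F x.
Proof.
by move=> /andP[x0 x1]; rewrite -(score_cdf0 _ f) score_cdf_le ?lexx.
Qed.

(** As [f] is merely integrable, [F] need not be differentiable everywhere. The mean value theorem
    is applied to [p] between [F u] and [F v], and the intermediate value theorem for the continuous
    [F] pulls the intermediate point back to [xi]. *)
Lemma horner_score_cdf_MVT (p : {poly R}) u v : 0 <= u -> u <= v -> v <= 1 ->
  exists2 xi, u <= xi <= v & p.[F v] - p.[F u] =
    p^`().[F xi] * \int[@lebesgue_measure R]_(x in `]u, v]) f x.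
Proof.
move=> u0 uv v1; have Fuv : F u <= F v by exact: score_cdf_le.
have [eta etaF peta] : exists2 eta, eta \in `[F u, F v] &
    p.[F v] - p.[F u] = p^`().[eta] * (F v - F u).
  apply: (@MVT_segment _ (horner p) (horner p^`()) _ _ Fuv).
  by apply: continuous_subspaceT => x; exact: continuous_horner.
have cF : {within `[u, v], continuous F}.
  apply: continuous_subspaceW (score_cdf_continuous _ _ f_int).
  by apply: subset_itv; rewrite bnd_simp.
have [|xi xiuv Fxi] := @IVT _ _ _ _ eta uv cF.
  by move: etaF; rewrite in_itv/= (min_idPl Fuv) (max_idPr Fuv).
exists xi; first by move: xiuv; rewrite in_itv.
by rewrite Fxi peta score_cdf_increment.
Qed.

(* Chain rule for the absolutely continuous function [p \o F]. *)
Lemma Rintegral_deriv_score_cdf (p : {poly R}) s : 0 <= s <= 1 ->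
  \int[@lebesgue_measure R]_(x in `[0, s]) (p^`().[F x] * f x) =
  p.[F s] - p.[0].
Proof.
move=> s01.
(* One inequality for every polynomial; used for [p] and for [- p], it gives the equality. *)
have half (q : {poly R}) :
    \int[@lebesgue_measure R]_(x in `[0, s]) (q^`().[F x] * f x) <=
    q.[F s] - q.[F 0].
  apply: (@Rintegral_le_increment R f (fun x => q^`().[F x])
    (fun x => q.[F x]) 0 1) => //; first exact: horner_score_cdf_continuous.
  move=> u v u0 uv v1; have [xi xiuv ->] := horner_score_cdf_MVT q _ _ u0 uv v1.
  by exists xi.
have := half p; rewrite score_cdf0; have := half (- p).
rewrite score_cdf0 !hornerN derivN.
under eq_Rintegral do rewrite hornerN mulNr -mulN1r.
rewrite RintegralZl//; first lra.
move/andP: (s01) => [s0 s1].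
apply: (@integrableS _ _ _ (@lebesgue_measure R) `[0, 1]) => //.
  by apply: subset_itvl; rewrite bnd_simp.
apply: (@integrable_within_continuousM _ f (fun x => p^`().[F x]) 0 1) => //.
exact: horner_score_cdf_continuous.
Qed.

Lemma binom_tail_horner0 n c : (c <= n)%N -> (binom_tail R n c).[0] = 0.
Proof.
move=> cn; rewrite /binom_tail horner_sum big1// => a _.
rewrite /binom_term hornerZ hornerM horner_exp hornerXn expr0n.
by rewrite subn_eq0 leqNgt (leq_trans (ltn_ord a))//= !mulr0.
Qed.

(** The order statistic of rank [(n - c).+1] is at most [s] exactly when fewer than [c] scores
    exceed [s]. Analytically, its density is the derivative of the tail, taken at [F x], times
    [f x]. *)
Lemma Rintegral_os_density n c s : (0 < c <= n)%N -> 0 <= s <= 1 ->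
  \int[@lebesgue_measure R]_(x in `[0, s]) os_density F f n (n - c).+1 x =
  (binom_tail R n c).[F s].
Proof.
move=> /andP[c0 cn] s01.
have := Rintegral_deriv_score_cdf (binom_tail R n c) s s01.
rewrite binom_tail_horner0// subr0 => <-.
apply: eq_Rintegral => x _; rewrite /os_density binom_tail_deriv.
rewrite hornerZ hornerM horner_exp hornerD hornerN hornerX hornerC hornerXn.
congr (_ * _).
have -> : (n - (n - c).+1 = c.-1)%N by lia.
have -> : (c * 'C(n, c) = (n - c).+1 * 'C(n, (n - c).+1))%N.
  by rewrite mul_bin_left bin_sub// subKn.
by rewrite natrM -!mulrA [X in _ * (_ * X)]mulrC.
Qed.

End density.

(* At [x = F0 s] and [y = F1 s], the probability that fewer than [nk] of [n0]
   non-fraudulent and [n] fraudulent scores exceed [s]. *)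
Definition rank_tail (R : realType) (n0 n nk : nat) (x y : R) : R :=
  \sum_(b < nk) (binom_term R n b).[y] * (binom_tail R n0 (nk - b)).[x].

(** * Bounds and monotonicity of binomial and rank tails *)

Lemma horner_binom_term (R : realType) (n a : nat) (x : R) :
  (binom_term R n a).[x] = 'C(n, a)%:R * ((1 - x) ^+ a * x ^+ (n - a)).
Proof.
by rewrite hornerZ hornerM horner_exp hornerXn hornerD hornerN hornerX hornerC.
Qed.

Lemma binom_term_ge0 (R : realType) (n a : nat) (x : R) : 0 <= x <= 1 ->
  0 <= (binom_term R n a).[x].
Proof.
move=> /andP[x0 x1]; rewrite horner_binom_term.
by rewrite !mulr_ge0 ?exprn_ge0// subr_ge0.
Qed.

Lemma binom_tail_ge0 (R : realType) (n c : nat) (x : R) : 0 <= x <= 1 ->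
  0 <= (binom_tail R n c).[x].
Proof.
by move=> x01; rewrite horner_sum sumr_ge0// => a _; exact: binom_term_ge0.
Qed.

Lemma binom_tail_homo (R : realType) (n c c' : nat) (x : R) : 0 <= x <= 1 ->
  (c <= c')%N -> (binom_tail R n c).[x] <= (binom_tail R n c').[x].
Proof.
move=> x01 /subnKC <-; elim: (c' - c)%N => [|m IH]; first by rewrite addn0.
rewrite addnS {2}/binom_tail big_ord_recr hornerD; apply: (le_trans IH).
by rewrite lerDl binom_term_ge0.
Qed.

(** Adding terms can only raise the tail, and from [n.+1] terms on it is the whole expansion of
    [(x + (1 - x)) ^+ n]. *)
Lemma binom_tail_le1 (R : realType) (n c : nat) (x : R) : 0 <= x <= 1 ->
  (binom_tail R n c).[x] <= 1.
Proof.
move=> x01; suff <- : (binom_tail R n (n.+1 + c)).[x] = 1.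
  by apply: binom_tail_homo => //; rewrite leq_addl.
elim: c => [|m IH]; last first.
  rewrite addnS /binom_tail big_ord_recr hornerD -/(binom_tail R n _) IH.
  by rewrite horner_binom_term bin_small ?leq_addr// mul0r addr0.
rewrite addn0 horner_sum -[RHS](expr1n R n) -[X in _ = X ^+ n](subrKC x).
rewrite exprDn; apply: eq_bigr => a _.
by rewrite horner_binom_term mulr_natl [_ ^+ a * _]mulrC.
Qed.

Lemma rank_tail0_le1 (R : realType) (n0 nk : nat) (x y : R) : 0 <= x <= 1 ->
  rank_tail R n0 0 nk x y <= 1.
Proof.
move=> x01; rewrite /rank_tail; case: nk => [|k]; first by rewrite big_ord0.
rewrite big_ord_recl big1; last first.
  by move=> b _; rewrite horner_binom_term bin0n !mul0r.
by rewrite horner_binom_term bin0 expr0 !mul1r addr0 binom_tail_le1.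
Qed.

Lemma rank_tail_ge0 (R : realType) (n0 n nk : nat) (x y : R) :
  0 <= x <= 1 -> 0 <= y <= 1 -> 0 <= rank_tail R n0 n nk x y.
Proof.
move=> x01 y01; apply: sumr_ge0 => b _.
by rewrite mulr_ge0 ?binom_term_ge0 ?binom_tail_ge0.
Qed.

Lemma binom_termS0 (R : realType) (n : nat) (y : R) :
  (binom_term R n.+1 0).[y] = y * (binom_term R n 0).[y].
Proof. by rewrite !horner_binom_term !bin0 !subn0 exprS; ring. Qed.

(** Pascal's rule, read as conditioning on one additional score: it stays below the threshold with
    probability [y] and exceeds it with probability [1 - y]. *)
Lemma binom_termSS (R : realType) (n b : nat) (y : R) :
  (binom_term R n.+1 b.+1).[y] =
  y * (binom_term R n b.+1).[y] + (1 - y) * (binom_term R n b).[y].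
Proof.
rewrite !horner_binom_term binS natrD subSS; have [bn|nb] := ltnP b n.
  by rewrite -(subnSK bn) !exprS; ring.
(* For [n <= b] the exponent [n - b.+1] is truncated, but its coefficient ['C(n, b.+1)] is zero. *)
by rewrite (@bin_small n b.+1)// !mul0r mulr0 !add0r exprS; ring.
Qed.

(** Condition on the additional fraudulent score. If it stays below the threshold, nothing changes;
    if it exceeds it, one place of the capacity is taken and the tails over the [n0] scores get
    shorter. The new value is thus a convex combination of the old one and something no larger. *)
Lemma rank_tailS_le (R : realType) (n0 n nk : nat) (x y : R) :
  0 <= x <= 1 -> 0 <= y <= 1 ->
  rank_tail R n0 n.+1 nk x y <= rank_tail R n0 n nk x y.
Proof.
move=> x01 y01; case: nk => [|k]; first by rewrite /rank_tail !big_ord0.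
pose t b := (binom_tail R n0 (k.+1 - b)).[x].
pose p b := (binom_term R n b).[y].
have -> : rank_tail R n0 n.+1 k.+1 x y =
    y * rank_tail R n0 n k.+1 x y + (1 - y) * \sum_(b < k) p b * t b.+1.
  rewrite /rank_tail big_ord_recl [in RHS]big_ord_recl binom_termS0.
  rewrite -mulrA mulrDr -addrA; congr (_ + _).
  rewrite !mulr_sumr -big_split; apply: eq_bigr => b _ /=.
  by rewrite binom_termSS /p /t; ring.
have : \sum_(b < k) p b * t b.+1 <= rank_tail R n0 n k.+1 x y.
  rewrite /rank_tail big_ord_recr/= -[leLHS]addr0 lerD//.
    apply: ler_sum => b _; rewrite ler_wpM2l ?binom_term_ge0//.
    by apply: binom_tail_homo => //; lia.
  by rewrite mulr_ge0 ?binom_term_ge0 ?binom_tail_ge0.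
have /andP[y0 y1] := y01.
rewrite -subr_ge0 => h; rewrite -subr_ge0.
have y1' : 0 <= 1 - y by rewrite subr_ge0.
have := mulr_ge0 y1' h; congr (_ <= _); ring.
Qed.

(** * Bounding the sum of the [FW] by an integral of the rank tail *)

Lemma within_continuous_sum (R : realType) (n : nat) (H : nat -> R -> R)
    (A : set R) : (forall i, {within A, continuous (H i)}) ->
  {within A, continuous (fun x => \sum_(i < n) H i x)}.
Proof.
move=> cH; elim: n => [|m IH].
  rewrite (_ : (fun x => _) = cst 0); last by apply/funext => x; rewrite big_ord0.
  by apply: continuous_subspaceT => x; exact: cvg_cst.
rewrite (_ : (fun x => _) = (fun x => \sum_(i < m) H i x) + H m); last first.
  by apply/funext => x; rewrite big_ord_recr.
exact: within_continuousD.
Qed.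

Lemma Rintegral_sum_continuousM (R : realType) (f : R -> R) (n : nat)
    (H : nat -> R -> R) (a b : R) :
  (@lebesgue_measure R).-integrable `[a, b] (EFin \o f) ->
  (forall i, {within `[a, b], continuous (H i)}) ->
  \int[@lebesgue_measure R]_(x in `[a, b]) ((\sum_(i < n) H i x) * f x) =
  \sum_(i < n) \int[@lebesgue_measure R]_(x in `[a, b]) (H i x * f x).
Proof.
move=> fi cH.
elim: n => [|n IH].
  rewrite big_ord0; under eq_Rintegral do rewrite big_ord0 mul0r.
  by rewrite Rintegral_cst// mul0r.
rewrite big_ord_recr/= -IH -RintegralD//.
- by apply: eq_Rintegral => x _; rewrite big_ord_recr mulrDl.
- exact: (integrable_within_continuousM _ _ _ _ _ (within_continuous_sum _ n _ _ cH) fi).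
- exact: (integrable_within_continuousM _ _ _ _ _ (cH n) fi).
Qed.

Lemma score_cdf_01 (R : realType) (f : R -> R) :
  (forall x, 0 <= x <= 1 -> 0 <= f x) ->
  (@lebesgue_measure R).-integrable `[0, 1] (EFin \o f) ->
  \int[@lebesgue_measure R]_(x in `[0, 1]) f x = 1 ->
  forall x, 0 <= x <= 1 -> 0 <= score_cdf f x <= 1.
Proof.
move=> f0 fi f1 x x01; rewrite score_cdf_ge0//=.
have /andP[x0 x1] := x01.
by rewrite -[leRHS]f1 -score_cdfE ?lexx ?ler01// score_cdf_le.
Qed.

Lemma within_continuous_rank_term (R : realType) (f0 f1 : R -> R)
    (p q : {poly R}) :
  (@lebesgue_measure R).-integrable `[0, 1] (EFin \o f0) ->
  (@lebesgue_measure R).-integrable `[0, 1] (EFin \o f1) ->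
  {within `[0, 1],
    continuous (fun s => p.[score_cdf f1 s] * q.[score_cdf f0 s])}.
Proof.
move=> fi0 fi1 x; apply: cvgM; exact: horner_score_cdf_continuous.
Qed.

(** Term by term, with [j = b.+1]: the fraudulent density is [n1] times the probability of [b]
    exceedances among the other [n1.-1] scores, and the inner integral is the binomial tail with
    [c = nk - b]. *)
Lemma FW_sum_le (R : realType) (f0 f1 : R -> R) (nk n0 n1 : nat) :
  (forall x, 0 <= x <= 1 -> 0 <= f0 x) ->
  (forall x, 0 <= x <= 1 -> 0 <= f1 x) ->
  (@lebesgue_measure R).-integrable `[0, 1] (EFin \o f0) ->
  (@lebesgue_measure R).-integrable `[0, 1] (EFin \o f1) ->
  \int[@lebesgue_measure R]_(x in `[0, 1]) f0 x = 1 ->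
  \int[@lebesgue_measure R]_(x in `[0, 1]) f1 x = 1 ->
  FW_sum f0 f1 nk n0 n1 <=
  n1%:R * \int[@lebesgue_measure R]_(s in `[0, 1])
     (rank_tail R n0 n1.-1 nk (score_cdf f0 s) (score_cdf f1 s) * f1 s).
Proof.
move=> f0_ge0 f1_ge0 f0i f1i f0_1 f1_1.
pose F0 := score_cdf f0; pose F1 := score_cdf f1.
have F0_01 := score_cdf_01 _ _ f0_ge0 f0i f0_1.
have F1_01 := score_cdf_01 _ _ f1_ge0 f1i f1_1.
pose H b s := (binom_term R n1.-1 b).[F1 s] * (binom_tail R n0 (nk - b)).[F0 s].
have cH b : {within `[0, 1], continuous (H b)}.
  exact: within_continuous_rank_term.
have Hi b := integrable_within_continuousM _ _ _ _ _ (cH b) f1i.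
rewrite (Rintegral_sum_continuousM _ _ _ H)// mulr_sumr.
rewrite /FW_sum big_add1/= big_mkord.
have term_ge0 b : 0 <= n1%:R *
    \int[@lebesgue_measure R]_(s in `[0, 1]) (H b s * f1 s).
  rewrite mulr_ge0// Rintegral_ge0// => s; rewrite /= in_itv/= => s01.
  by rewrite !mulr_ge0 ?f1_ge0 ?binom_term_ge0 ?binom_tail_ge0 ?F0_01 ?F1_01.
rewrite (big_ord_widen nk (fun i => FW f0 f1 nk n0 n1 i.+1 0)) ?geq_minl//.
rewrite big_mkcond; apply: ler_sum => b _; case: ifPn => // bn.
have /andP[bk bn1] : (b < nk)%N && (b < n1)%N by rewrite -leq_min.
(* The factor [n1 * 'C(n1.-1, b)] chooses the arrival holding this rank, then the [b] arrivals above
   it. *)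
have osE s : os_density F1 f1 n1 (rho1 n1 b.+1) s =
    n1%:R * (binom_term R n1.-1 b).[F1 s] * f1 s.
  rewrite /os_density /rho1 horner_binom_term /= -natrM.
  have -> : (n1 - (n1 - b.+1).+1 = b)%N by lia.
  have -> : (n1.-1 - b = n1 - b.+1)%N by lia.
  rewrite -mul_bin_diag natrM (_ : (n1 - b.+1 = n1.-1 - b)%N); last by lia.
  by rewrite bin_sub; [ring|lia].
(* With fewer than [nk - b] non-fraudulent scores, [rho0] truncates to 0 and the factor [i%:R] of
   the density makes [FW] vanish, whereas the right-hand term is only known to be nonnegative. *)
have [c_le|n0_lt] := leqP (nk - b) n0; last first.
  suff -> : FW f0 f1 nk n0 n1 b.+1 0 = 0 by [].
  rewrite /FW; under eq_Rintegral => s _.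
    under eq_Rintegral => s' _.
      rewrite /os_density /rho0 (_ : (n0 + b.+1 - nk = 0)%N); last by lia.
      rewrite !mul0r; over.
    rewrite Rintegral_cst// !mul0r; over.
  by rewrite Rintegral_cst// mul0r.
rewrite -RintegralZl// le_eqVlt; apply/orP; left; apply/eqP.
apply: eq_Rintegral => s; rewrite inE/= in_itv/= => s01.
rewrite osE add0r /rho0 (_ : (n0 + b.+1 - nk = (n0 - (nk - b)).+1)%N); last by lia.
rewrite Rintegral_os_density//; last by apply/andP; split; lia.
by rewrite /H -/F0; ring.
Qed.

Lemma FW_sum_ge0 (R : realType) (f0 f1 : R -> R) (nk n0 n1 : nat) :
  (forall x, 0 <= x <= 1 -> 0 <= f0 x) ->
  (forall x, 0 <= x <= 1 -> 0 <= f1 x) ->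
  (@lebesgue_measure R).-integrable `[0, 1] (EFin \o f0) ->
  (@lebesgue_measure R).-integrable `[0, 1] (EFin \o f1) ->
  \int[@lebesgue_measure R]_(x in `[0, 1]) f0 x = 1 ->
  \int[@lebesgue_measure R]_(x in `[0, 1]) f1 x = 1 ->
  0 <= FW_sum f0 f1 nk n0 n1.
Proof.
move=> f0_ge0 f1_ge0 f0i f1i f0_1 f1_1.
have os_ge0 f n i s : (forall x, 0 <= x <= 1 -> 0 <= f x) ->
    (@lebesgue_measure R).-integrable `[0, 1] (EFin \o f) ->
    \int[@lebesgue_measure R]_(x in `[0, 1]) f x = 1 -> 0 <= s <= 1 ->
    0 <= os_density (score_cdf f) f n i s.
  move=> f_ge0 fi f_1 s01.
  have /andP[F0 F1] := score_cdf_01 _ _ f_ge0 fi f_1 _ s01.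
  by rewrite !mulr_ge0 ?exprn_ge0 ?subr_ge0 ?f_ge0.
apply: sumr_ge0 => j _; apply: Rintegral_ge0 => s; rewrite /= in_itv/= => s01.
rewrite mulr_ge0 ?os_ge0//; apply: Rintegral_ge0 => x.
rewrite /= in_itv/= add0r => /andP[x0 xs]; apply: os_ge0 => //.
by rewrite x0 (le_trans xs)//; case/andP: s01.
Qed.

(** * Binomial and rank tails as sums over sets of exceeding scores *)

Lemma sum_subsets (R : realType) (I : finType) (D : {set I}) (c : nat)
    (h : nat -> R) :
  \sum_(A : {set I} | (A \subset D) && (#|A| < c)%N) h #|A| =
  \sum_(a < c) 'C(#|D|, a)%:R * h a.
Proof.
transitivity (\sum_(a < c) \sum_(A : {set I} | (A \subset D) && (#|A| == a :> nat))
    h a).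
  rewrite (exchange_big_dep (fun A : {set I} => (A \subset D) && (#|A| < c)%N))/=.
    apply: eq_bigr => A /andP[AD Ac].
    rewrite (big_pred1 (Ordinal Ac))// => a.
    by rewrite AD/= -val_eqE eq_sym.
  by move=> a A _ /andP[-> /eqP ->] /=.
apply: eq_bigr => a _; rewrite sumr_const -cards_draws mulr_natl.
by congr (_ *+ _); apply: eq_card => A; rewrite !inE.
Qed.

Lemma prod_subset (R : realType) (I : finType) (A D : {set I}) (p q : R) :
  A \subset D ->
  \prod_(i in D) (if i \in A then p else q) = p ^+ #|A| * q ^+ (#|D| - #|A|).
Proof.
move=> AD; rewrite (bigID (fun i => i \in A))/=; congr (_ * _).
  rewrite (eq_bigr (fun=> p)); last by move=> i /andP[_ ->].
  rewrite prodr_const; congr (_ ^+ _); apply: eq_card => i; rewrite unfold_in/=.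
  by have [/(fintype.subsetP AD) ->|] := boolP (i \in A); rewrite ?andbF.
rewrite (eq_bigr (fun=> q)); last by move=> i /andP[_ /negbTE ->].
rewrite prodr_const -cardsDS//; congr (_ ^+ _).
by apply: eq_card => i; rewrite !inE andbC.
Qed.

(** Here [A] is the exact set of scores above the threshold. Such patterns are disjoint events, and
    independence gives each a product as its probability. *)
Lemma binom_tailE (R : realType) (I : finType) (D : {set I}) (c : nat) (x : R) :
  \sum_(A : {set I} | (A \subset D) && (#|A| < c)%N)
     \prod_(i in D) (if i \in A then 1 - x else x) = (binom_tail R #|D| c).[x].
Proof.
rewrite (eq_bigr (fun A : {set I} => (1 - x) ^+ #|A| * x ^+ (#|D| - #|A|))).
  rewrite (sum_subsets _ _ _ _ (fun a => (1 - x) ^+ a * x ^+ (#|D| - a))).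
  by rewrite horner_sum; apply: eq_bigr => a _; rewrite horner_binom_term.
by move=> A /andP[AD _]; rewrite prod_subset.
Qed.

(** [BA.1] and [BA.2] collect the fraudulent and the non-fraudulent scores above the threshold. The
    arrival [j] under inspection is left out, hence [#|J|.-1]. *)
Lemma rank_tailE (R : realType) (I J : finType) (j : J) (nk : nat) (x y : R) :
  \sum_(BA : {set J} * {set I} | [&& BA.1 \subset [set~ j]%SET, (#|BA.1| < nk)%N &
       (#|BA.2| < nk - #|BA.1|)%N])
     (\prod_(i in [set~ j]%SET) (if i \in BA.1 then 1 - y else y)) *
     (\prod_i (if i \in BA.2 then 1 - x else x)) =
  rank_tail R #|I| #|J|.-1 nk x y.
Proof.
pose Q (B : {set J}) := (B \subset [set~ j]%SET) && (#|B| < nk)%N.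
rewrite (eq_bigl (fun BA : {set J} * {set I} =>
    Q BA.1 && (#|BA.2| < nk - #|BA.1|)%N)); last first.
  by move=> BA; rewrite -andbA.
rewrite -(pair_big_dep Q (fun B (A : {set I}) => (#|A| < nk - #|B|)%N)
  (fun B A => (\prod_(i in [set~ j]%SET) (if i \in B then 1 - y else y)) *
     (\prod_i (if i \in A then 1 - x else x))))/=.
pose h b := (1 - y) ^+ b * y ^+ (#|J|.-1 - b) * (binom_tail R #|I| (nk - b)).[x].
rewrite (eq_bigr (fun B : {set J} => h #|B|)); last first.
  move=> B /andP[BD _]. rewrite -mulr_sumr prod_subset// cardsC1.
  congr (_ * _); rewrite -finset.cardsT -binom_tailE; apply: eq_big => A.
    by rewrite finset.subsetT.
  by move=> _; apply: eq_bigl => i; rewrite inE.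
rewrite sum_subsets cardsC1; apply: eq_bigr => b _.
by rewrite horner_binom_term /h !mulrA.
Qed.

(** * Real-valued probabilities, ranks and exceedance patterns *)

Section probability_of_sets.
Variables (R : realType) (d : measure_display) (T : measurableType d).
Variable P : probability T R.

Lemma EFin_pr A : measurable A -> (pr P A)%:E = P A.
Proof. by move=> mA; rewrite /pr fineK// fin_num_measure. Qed.

Lemma pr_ge0 A : 0 <= pr P A.
Proof. by rewrite /pr fine_ge0. Qed.

Lemma le_pr A B : measurable A -> measurable B -> A `<=` B ->
  pr P A <= pr P B.
Proof.
by move=> mA mB AB; rewrite -lee_fin !EFin_pr// le_measure ?inE.
Qed.

Lemma prD A B : measurable A -> measurable B -> A `<=` B ->
  pr P (B `\` A) = pr P B - pr P A.
Proof.
move=> mA mB AB; apply: EFin_inj; rewrite EFinB !EFin_pr//; last first.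
  exact: measurableD.
rewrite measureD//; first by rewrite (setIidPr _ _).2.
by rewrite ltey_eq fin_num_measure.
Qed.

(** Induction on [s]: by disjointness the remaining sets still fit into [E] once [C i] is removed
    from it. *)
Lemma sum_pr_le (I : eqType) (s : seq I) (C : I -> set T) (E : set T) :
  uniq s -> measurable E -> (forall i, measurable (C i)) ->
  (forall i, i \in s -> C i `<=` E) ->
  (forall i j, i \in s -> j \in s -> C i `&` C j !=set0 -> i = j) ->
  \sum_(i <- s) pr P (C i) <= pr P E.
Proof.
move=> + + mC; elim: s E => [|i s IH] E; first by rewrite big_nil pr_ge0.
move=> /= /andP[is_ us] mE CE dC; rewrite big_cons.
have CiE : C i `<=` E by apply: CE; rewrite mem_head.
suff : \sum_(j <- s) pr P (C j) <= pr P (E `\` C i) by rewrite prD//; lra.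
apply: IH => //; first exact: measurableD.
  move=> j js w Cjw; split; first by apply: (CE j) => //; rewrite inE js orbT.
  move=> Ciw; have ij : i = j.
    by apply: dC; rewrite ?mem_head ?inE ?js ?orbT//; exists w.
  by move: is_; rewrite ij js.
by move=> j j' js j's; apply: dC; rewrite inE ?js ?j's orbT.
Qed.

End probability_of_sets.

(** The set notation in [bp_rank] and [bp_detected] denotes classical sets; this gives access to the
    counting lemmas for finite sets. *)
Lemma card_classical_set (I : finType) (b : I -> bool) :
  #|[set i | b i]| = #|[set i | b i]%SET|.
Proof. by apply: eq_card => i; apply/idP/idP; rewrite !inE. Qed.

(** Whatever is ranked ahead of [j], ties included, scores at least [s1 j] and so more than [u]; and
    [j] is not ahead of itself. *)
Lemma bp_rank_le (R : realType) (s0 s1 : nat -> R) (n0 n1 : nat) (j : 'I_n1)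
    (u : R) (A : {set 'I_n0}) (B : {set 'I_n1}) :
  u < s1 j -> (forall i : 'I_n0, u < s0 i -> i \in A) ->
  (forall i : 'I_n1, i != j -> u < s1 i -> i \in B) ->
  (bp_rank s0 s1 n0 n1 j <= #|B| + #|A|)%N.
Proof.
move=> uj Aall Ball; rewrite /bp_rank addnC; apply: leq_add.
  apply: subset_leq_card; apply/fintype.subsetP => i; rewrite !inE => Hi.
  apply: Ball; first by apply: contraTneq Hi => ->; rewrite ltxx ltnn andbF.
  by case/orP: Hi => [/(lt_trans uj)//|/andP[/eqP ->]].
apply: subset_leq_card; apply/fintype.subsetP => i; rewrite !inE => ji.
by apply: Aall; exact: lt_le_trans ji.
Qed.

Definition halfline (R : realType) (u : R) (above : bool) : set R :=
  if above then `]u, +oo[%classic else `]-oo, u]%classic.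

Lemma halflineP (R : realType) (u x : R) (b : bool) :
  halfline R u b x -> b = (u < x).
Proof.
rewrite /halfline; case: b => /=; rewrite in_itv/= ?andbT => h.
  by rewrite h.
by apply/esym/negbTE; rewrite -leNgt.
Qed.

Lemma measurable_halfline (R : realType) (u : R) (b : bool) :
  measurable (halfline R u b).
Proof. by case: b; exact: measurable_itv. Qed.

Lemma prod_iota (R : realType) (n : nat) (F : nat -> R) :
  \prod_(i <- iota 0 n) F i = \prod_(i < n) F i.
Proof. by rewrite -(big_mkord xpredT) /index_iota subn0. Qed.

(** Scores are indexed by all of [nat], patterns by ordinals; membership is extended by [false] from
    [n] on. *)
Definition nat_mem (n : nat) (A : {set 'I_n}) (i : nat) : bool :=
  if insub i is Some x then x \in A else false.

Lemma nat_memE (n : nat) (A : {set 'I_n}) (i : 'I_n) : nat_mem n A i = (i \in A).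
Proof. by rewrite /nat_mem valK. Qed.

Lemma measurable_forall_in (d d' : measure_display) (T : measurableType d)
    (U : measurableType d') (X : nat -> T -> U) (s : seq nat) (A : nat -> set U) :
  (forall i, measurable_fun setT (X i)) -> (forall i, measurable (A i)) ->
  measurable [set w | forall i, i \in s -> A i (X i w)].
Proof.
move=> mX mA.
rewrite (_ : [set w | _] = \bigcap_(i in [set` s]) (X i @^-1` A i)) //.
apply: bigcap_measurableType => i _.
by rewrite -[X in measurable X]setTI; exact: mX.
Qed.

Lemma measurable_card (R : realType) (d : measure_display) (T : measurableType d)
    (I : finType) (b : I -> T -> bool) :
  (forall i, measurable_fun setT (b i)) ->
  measurable_fun setT (fun w => #|[set i | b i w]|%:R : R).
Proof.
move=> mb.
rewrite (_ : (fun w => _) = fun w => \sum_(i in I) \1_(b i @^-1` [set true]) w :> R).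
  apply: measurable_sum => i; apply: measurable_indic.
  by rewrite -[X in measurable X]setTI; exact: mb.
apply/funext => w; rewrite card_classical_set -sum1_card natr_sum big_mkcond/=.
apply: eq_bigr => i _; rewrite inE indicE.
have -> : (w \in b i @^-1` [set true]) = b i w.
  by apply/idP/idP; rewrite inE.
by case: (b i w).
Qed.

(** * Probability of inspection for given counts *)

Section independent_scores.
Variables (R : realType) (d : measure_display) (T : measurableType d).
Variables (P : probability T R) (N0 N1 : T -> nat) (S0 S1 : nat -> T -> R).
Variables (f0 f1 : R -> R).
Hypothesis f0_ge0 : forall x, 0 <= x <= 1 -> 0 <= f0 x.
Hypothesis f1_ge0 : forall x, 0 <= x <= 1 -> 0 <= f1 x.
Hypothesis f0_int : (@lebesgue_measure R).-integrable `[0, 1] (EFin \o f0).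
Hypothesis f1_int : (@lebesgue_measure R).-integrable `[0, 1] (EFin \o f1).
Hypothesis mN0 : forall n, measurable (N0 @^-1` [set n]).
Hypothesis mN1 : forall n, measurable (N1 @^-1` [set n]).
Hypothesis mS0 : forall i, measurable_fun setT (S0 i).
Hypothesis mS1 : forall i, measurable_fun setT (S1 i).
Hypothesis S0_law : forall i B, measurable B ->
  pr P (S0 i @^-1` B) = \int[@lebesgue_measure R]_(x in B `&` `[0, 1]) f0 x.
Hypothesis S1_law : forall i B, measurable B ->
  pr P (S1 i @^-1` B) = \int[@lebesgue_measure R]_(x in B `&` `[0, 1]) f1 x.
Hypothesis indep : forall (n0 n1 : nat) (I J : seq nat) (A B : nat -> set R),
  uniq I -> uniq J ->
  (forall i, measurable (A i)) -> (forall j, measurable (B j)) ->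
  pr P [set w | [/\ N0 w = n0, N1 w = n1,
                   (forall i, i \in I -> A i (S0 i w)) &
                   (forall j, j \in J -> B j (S1 j w))]]
  = pr P (N0 @^-1` [set n0]) * pr P (N1 @^-1` [set n1])
    * \prod_(i <- I) pr P (S0 i @^-1` A i)
    * \prod_(j <- J) pr P (S1 j @^-1` B j).

Definition counts (n0 n1 : nat) : set T := N0 @^-1` [set n0] `&` N1 @^-1` [set n1].

Definition inspected (nk n0 n1 j : nat) : set T :=
  [set w | (bp_rank (fun i => S0 i w) (fun i => S1 i w) n0 n1 j < nk)%N].

Lemma measurable_counts n0 n1 : measurable (counts n0 n1).
Proof. exact: measurableI. Qed.

Lemma measurable_inspected nk n0 n1 j : measurable (inspected nk n0 n1 j).
Proof.
pose r w := bp_rank (fun i => S0 i w) (fun i => S1 i w) n0 n1 j.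
have mr : measurable_fun setT (fun w => (r w)%:R : R).
  rewrite /r /bp_rank; under eq_fun do rewrite natrD.
  apply: measurable_funD; apply: measurable_card => i.
    exact: measurable_fun_ler.
  apply: measurable_or; first exact: measurable_fun_ltr.
  apply: measurable_and; last exact: measurable_cst.
  exact: measurable_fun_eqr.
rewrite (_ : inspected _ _ _ _ = (fun w => (r w)%:R) @^-1` `]-oo, (nk%:R : R)[).
  by rewrite -[X in measurable X]setTI; apply: mr => //; exact: measurable_itv.
by apply/seteqP; split => w; rewrite /inspected /= in_itv/= ltr_nat.
Qed.

Lemma pr_halfline (f : R -> R) (X : T -> R) u b :
  (forall x, 0 <= x <= 1 -> 0 <= f x) ->
  measurable_fun setT X ->
  (forall B, measurable B ->
    pr P (X @^-1` B) = \int[@lebesgue_measure R]_(x in B `&` `[0, 1]) f x) ->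
  pr P (X @^-1` halfline R u b) =
  if b then 1 - score_cdf f u else score_cdf f u.
Proof.
move=> f_ge0 mX law.
have below : pr P (X @^-1` `]-oo, u]) = score_cdf f u.
  rewrite law; last exact: measurable_itv.
  by congr Rintegral; apply/seteqP; split => x /=; rewrite !in_itv/= => -[? ?].
case: b => //=; rewrite -below -[1]/(fine 1%E) -(probability_setT P).
rewrite -/(pr P setT) -prD//; last first.
  by rewrite -[X in measurable X]setTI; apply: mX => //; exact: measurable_itv.
congr (pr P _); apply/seteqP; split => w /=; rewrite !in_itv/= andbT.
  by move=> h; split => //; apply/negP; rewrite -ltNge.
by move=> [_ /negP]; rewrite -ltNge.
Qed.

(** Independence with no score constrained. *)
Lemma pr_counts n0 n1 :
  pr P (counts n0 n1) = pr P (N0 @^-1` [set n0]) * pr P (N1 @^-1` [set n1]).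
Proof.
have := indep n0 n1 [::] [::] (fun=> setT) (fun=> setT) isT isT
  (fun=> measurableT) (fun=> measurableT).
rewrite !big_nil !mulr1 => <-; congr (pr P _).
by apply/seteqP; split => w [].
Qed.

Lemma pr_score_pattern n0 n1 (j : 'I_n1) u v
    (A : {set 'I_n0}) (B : {set 'I_n1}) : 0 <= u -> u <= v -> v <= 1 ->
  pr P [set w | [/\ N0 w = n0, N1 w = n1,
     (forall i, i \in iota 0 n0 -> halfline R u (nat_mem n0 A i) (S0 i w)) &
     (forall i, i \in iota 0 n1 ->
       (if i == j :> nat then `]u, v]%classic
        else halfline R u (nat_mem n1 B i)) (S1 i w))]] =
  pr P (counts n0 n1) * (\int[@lebesgue_measure R]_(x in `]u, v]) f1 x) *
  ((\prod_(i in [set~ j]%SET)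
      (if i \in B then 1 - score_cdf f1 u else score_cdf f1 u)) *
   (\prod_i (if i \in A then 1 - score_cdf f0 u else score_cdf f0 u))).
Proof.
move=> u0 uv v1.
rewrite (indep n0 n1 (iota 0 n0) (iota 0 n1)
  (fun i => halfline R u (nat_mem n0 A i))
  (fun i => if i == j :> nat then `]u, v]%classic
        else halfline R u (nat_mem n1 B i))) ?iota_uniq//; last 2 first.
- by move=> i; exact: measurable_halfline.
- by move=> i; case: ifP => _; [exact: measurable_itv|exact: measurable_halfline].
rewrite -pr_counts -!mulrA; congr (_ * _).
have -> : \prod_(i <- iota 0 n0)
    pr P (S0 i @^-1` halfline R u (nat_mem n0 A i)) =
    \prod_i (if i \in A then 1 - score_cdf f0 u else score_cdf f0 u).
  rewrite prod_iota; apply: eq_bigr => i _.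
  by rewrite (pr_halfline f0 _ _ _ f0_ge0 (mS0 i) (S0_law i)) nat_memE.
rewrite prod_iota (bigD1 j)//= eqxx.
have -> : pr P (S1 j @^-1` `]u, v]) = \int[@lebesgue_measure R]_(x in `]u, v]) f1 x.
  rewrite S1_law; last exact: measurable_itv.
  congr Rintegral; apply/seteqP; split => x /=; rewrite !in_itv/=; first by case.
  by move=> /andP[ux xv]; split; [rewrite ux|apply/andP; split; lra].
rewrite mulrC -!mulrA; congr (_ * (_ * _)).
apply: eq_big => i; first by rewrite !inE.
move=> /negbTE ij; rewrite -val_eqE/= in ij.
by rewrite ij (pr_halfline f1 _ _ _ f1_ge0 (mS1 i) (S1_law i)) nat_memE.
Qed.

(** The left-hand side sums the probabilities of the disjoint patterns with score [j] in []u, v]]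
    and fewer than [nk] other scores above [u]. Each pattern forces [j] to be inspected. It is only
    a lower bound, since other scores between [u] and that of [j] are counted against [j]. *)
Lemma pr_inspected_increment nk n0 n1 (j : 'I_n1) u v :
  0 <= u -> u <= v -> v <= 1 ->
  pr P (counts n0 n1) *
    rank_tail R n0 n1.-1 nk (score_cdf f0 u) (score_cdf f1 u) *
    (\int[@lebesgue_measure R]_(x in `]u, v]) f1 x) <=
  pr P (counts n0 n1 `&` inspected nk n0 n1 j `&` S1 j @^-1` `]u, v]).
Proof.
move=> u0 uv v1.
pose C (BA : {set 'I_n1} * {set 'I_n0}) := [set w | [/\ N0 w = n0, N1 w = n1,
     (forall i, i \in iota 0 n0 -> halfline R u (nat_mem n0 BA.2 i) (S0 i w)) &
     (forall i, i \in iota 0 n1 ->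
       (if i == j :> nat then `]u, v]%classic
        else halfline R u (nat_mem n1 BA.1 i)) (S1 i w))]].
pose Q (BA : {set 'I_n1} * {set 'I_n0}) := [&& BA.1 \subset [set~ j]%SET,
  (#|BA.1| < nk)%N & (#|BA.2| < nk - #|BA.1|)%N].
(* An outcome determines its pattern away from [j]; this yields both the rank bound and the
   disjointness. *)
have C0 BA w : C BA w -> forall i : 'I_n0, (i \in BA.2) = (u < S0 i w).
  move=> [_ _ h _] i; rewrite -nat_memE; apply: halflineP; apply: h.
  by rewrite mem_iota add0n ltn_ord.
have C1 BA w : C BA w ->
    forall i : 'I_n1, i != j -> (i \in BA.1) = (u < S1 i w).
  move=> [_ _ _ h] i ij; rewrite -nat_memE; apply: halflineP.
  have := h i; rewrite mem_iota add0n ltn_ord => /(_ isT).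
  by rewrite -[i == j :> nat]/(i == j) (negbTE ij).
have Cj BA w : C BA w -> u < S1 j w <= v.
  move=> [_ _ _ /(_ j)]; rewrite mem_iota add0n ltn_ord eqxx => /(_ isT) /=.
  by rewrite in_itv.
have := rank_tailE R 'I_n0 'I_n1 j nk (score_cdf f0 u) (score_cdf f1 u).
rewrite !card_ord => <-; rewrite mulrAC.
rewrite mulr_sumr.
under eq_bigr do rewrite -pr_score_pattern//.
rewrite -big_filter -/Q.
apply: (@sum_pr_le R d T P _ _ C).
- by rewrite filter_uniq ?index_enum_uniq.
- apply: measurableI; first exact: measurableI (measurable_counts _ _)
    (measurable_inspected _ _ _ _).
  by rewrite -[X in measurable X]setTI; apply: mS1 => //; exact: measurable_itv.
- move=> BA.
  rewrite (_ : C BA = counts n0 n1 `&`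
    ([set w | forall i, i \in iota 0 n0 ->
        halfline R u (nat_mem n0 BA.2 i) (S0 i w)] `&`
     [set w | forall i, i \in iota 0 n1 ->
       (if i == j :> nat then `]u, v]%classic
        else halfline R u (nat_mem n1 BA.1 i)) (S1 i w)])).
    apply: measurableI; first exact: measurable_counts.
    apply: measurableI.
      apply: (measurable_forall_in _ _ _ _ S0 _ (fun i =>
        halfline R u (nat_mem n0 BA.2 i))) => // i; exact: measurable_halfline.
    apply: (measurable_forall_in _ _ _ _ S1 _ (fun i => if i == j :> nat
      then `]u, v]%classic else halfline R u (nat_mem n1 BA.1 i))) => // i.
    by case: ifP => _; [exact: measurable_itv|exact: measurable_halfline].
  by apply/seteqP; split => w; [case=> *; do !split|case=> -[? ?] [? ?]; split].
- move=> BA; rewrite mem_filter => /andP[/and3P[Bj Bk Ak] _] w Cw.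
  have /andP[uj jv] := Cj _ _ Cw.
  split; last by rewrite /= in_itv/= uj.
  split; first by case: Cw.
  apply: (@leq_ltn_trans (#|BA.1| + #|BA.2|)); last by rewrite -ltn_subRL.
  apply: (@bp_rank_le _ _ _ _ _ _ u) => //.
    by move=> i; rewrite (C0 _ _ Cw).
  by move=> i ij; rewrite (C1 _ _ Cw).
- move=> [B A] [B' A']; rewrite !mem_filter => /andP[/and3P[/= Bj _ _] _].
  move=> /andP[/and3P[/= Bj' _ _] _] [w [Cw Cw']].
  congr (_, _); apply/setP => i; last by rewrite (C0 _ _ Cw) (C0 _ _ Cw').
  (* At [j] the outcome does not determine membership, but both sets avoid [j] by [Q]. *)
  have [->|ij] := eqVneq i j; last by rewrite (C1 _ _ Cw) ?(C1 _ _ Cw').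
  have nj (D : {set 'I_n1}) : D \subset [set~ j]%SET -> (j \in D) = false.
    by move=> Dj; apply/negP => /(fintype.subsetP Dj); rewrite !inE eqxx.
  by rewrite !nj.
Qed.

(** * The conditional detection probability and its monotonicity *)

Hypothesis f0_1 : \int[@lebesgue_measure R]_(x in `[0, 1]) f0 x = 1.
Hypothesis f1_1 : \int[@lebesgue_measure R]_(x in `[0, 1]) f1 x = 1.

(** [n] counts the other fraudulent arrivals: [D (n0, n.+1)] is [detection nk n0 n]. *)
Definition detection (nk n0 n : nat) : R :=
  \int[@lebesgue_measure R]_(s in `[0, 1])
     (rank_tail R n0 n nk (score_cdf f0 s) (score_cdf f1 s) * f1 s).

Lemma rank_tail_continuous nk n0 n : {within `[0, 1],
  continuous (fun s => rank_tail R n0 n nk (score_cdf f0 s) (score_cdf f1 s))}.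
Proof.
apply: (within_continuous_sum _ nk (fun b s =>
  (binom_term R n b).[score_cdf f1 s] *
  (binom_tail R n0 (nk - b)).[score_cdf f0 s])) => b.
exact: within_continuous_rank_term.
Qed.

(** Let [Phi v] be the probability of the event together with a score of [j] at most [v]. Its
    increments dominate the rank tail times the [f1]-mass, so [Rintegral_le_increment] integrates
    this bound over the unit interval. *)
Lemma pr_inspected_ge nk n0 n1 (j : 'I_n1) :
  pr P (counts n0 n1) * detection nk n0 n1.-1 <=
  pr P (counts n0 n1 `&` inspected nk n0 n1 j).
Proof.
set p := pr P (counts n0 n1); set E := counts n0 n1 `&` _.
have mE : measurable E.
  exact: measurableI (measurable_counts _ _) (measurable_inspected _ _ _ _).
have mEv I : measurable (E `&` S1 j @^-1` [set` I : interval R]).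
  apply: measurableI => //.
  by rewrite -[X in measurable X]setTI; apply: mS1 => //; exact: measurable_itv.
pose Phi v := pr P (E `&` S1 j @^-1` `]-oo, v]).
have inc u v : 0 <= u -> u <= v -> v <= 1 -> exists2 xi, u <= xi <= v &
    p * rank_tail R n0 n1.-1 nk (score_cdf f0 xi) (score_cdf f1 xi) *
    (\int[@lebesgue_measure R]_(x in `]u, v]) f1 x) <= Phi v - Phi u.
  (* The left end point serves as [xi], because the patterns use the threshold [u]. *)
  move=> u0 uv v1; exists u; first by rewrite lexx.
  apply: (le_trans (pr_inspected_increment _ _ _ _ _ _ u0 uv v1)).
  rewrite /Phi -prD; [|exact: mEv|exact: mEv|]; last first.
    by move=> w [Ew]; rewrite /= !in_itv/= => wu; split => //; exact: le_trans uv.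
  apply: le_pr; [exact: mEv|by apply: measurableD; exact: mEv|].
  move=> w [Ew]; rewrite /= !in_itv/= => /andP[uw wv]; split => //.
  by move=> [_]; rewrite leNgt uw.
have cH : {within `[0, 1], continuous
    (fun s => p * rank_tail R n0 n1.-1 nk (score_cdf f0 s) (score_cdf f1 s))}.
  by move=> x; apply: cvgM; [exact: cvg_cst|exact: rank_tail_continuous].
have h01 : 0 <= (1 : R) <= 1 by rewrite ler01 lexx.
have := Rintegral_le_increment _ _ _ Phi _ _ f1_ge0 f1_int cH inc 1 h01.
under eq_Rintegral do rewrite -mulrA.
rewrite RintegralZl//; last first.
  by apply: integrable_within_continuousM => //; exact: rank_tail_continuous.
move=> h; apply: (le_trans h).
have := pr_ge0 _ _ _ P (E `&` S1 j @^-1` `]-oo, 0]).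
have : Phi 1 <= pr P E by apply: le_pr; [exact: mEv| |move=> w []].
rewrite /Phi; lra.
Qed.

Lemma rank_tail_score_cdf_ge0 nk n0 n s : 0 <= s <= 1 ->
  0 <= rank_tail R n0 n nk (score_cdf f0 s) (score_cdf f1 s).
Proof. by move=> s01; apply: rank_tail_ge0; exact: score_cdf_01. Qed.

Lemma detection_integrable nk n0 n : (@lebesgue_measure R).-integrable `[0, 1]
  (EFin \o (fun s =>
    rank_tail R n0 n nk (score_cdf f0 s) (score_cdf f1 s) * f1 s)).
Proof.
by apply: integrable_within_continuousM => //; exact: rank_tail_continuous.
Qed.

Lemma detection_ge0 nk n0 n : 0 <= detection nk n0 n.
Proof.
apply: Rintegral_ge0 => s; rewrite /= in_itv/= => s01.
by rewrite mulr_ge0 ?f1_ge0 ?rank_tail_score_cdf_ge0.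
Qed.

Lemma detectionS_le nk n0 n : detection nk n0 n.+1 <= detection nk n0 n.
Proof.
apply: le_Rintegral => //; try exact: detection_integrable.
move=> s; rewrite /= in_itv/= => s01; rewrite ler_wpM2r ?f1_ge0//.
by apply: rank_tailS_le; exact: score_cdf_01.
Qed.

Lemma detection0_le1 nk n0 : detection nk n0 0 <= 1.
Proof.
rewrite -f1_1; apply: le_Rintegral => //; first exact: detection_integrable.
move=> s; rewrite /= in_itv/= => s01; rewrite ler_piMl ?f1_ge0//.
by apply: rank_tail0_le1; exact: score_cdf_01.
Qed.

(* With no fraudulent arrival the detected fraction is [1] by convention. *)
Definition detection_ratio (nk n0 n1 : nat) : R :=
  if n1 is n.+1 then detection nk n0 n else 1.

Lemma detection_ratio_ge0 nk n0 n1 : 0 <= detection_ratio nk n0 n1.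
Proof. by case: n1 => [|n] /=; rewrite ?ler01 ?detection_ge0. Qed.

Lemma detection_ratioS_le nk n0 n1 :
  detection_ratio nk n0 n1.+1 <= detection_ratio nk n0 n1.
Proof. by case: n1 => [|n] /=; [exact: detection0_le1|exact: detectionS_le]. Qed.

Lemma FW_sum_le_ratio nk n0 n1 :
  FW_sum f0 f1 nk n0 n1 <= n1%:R * detection_ratio nk n0 n1.
Proof.
apply: (le_trans (FW_sum_le _ _ _ _ _ _ f0_ge0 f1_ge0 f0_int f1_int f0_1 f1_1)).
by case: n1 => [|n] //=; rewrite !mul0r.
Qed.

(** * Expectations as iterated series over the counts *)

Lemma bigcup_counts n0 : \bigcup_n counts n0 n = N0 @^-1` [set n0].
Proof.
apply/seteqP; split => w; first by case=> n _ [].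
by move=> N0w; exists (N1 w).
Qed.

Lemma bigcup_N0 : \bigcup_n N0 @^-1` [set n] = [set: T].
Proof. by apply/seteqP; split => // w _; exists (N0 w). Qed.

Lemma measurable_fun_counts (g : T -> \bar R) :
  (forall n0 n1, measurable_fun (counts n0 n1) g) -> measurable_fun setT g.
Proof.
move=> mg; rewrite -bigcup_N0; apply/measurable_fun_bigcup => // n0.
rewrite -bigcup_counts; apply/measurable_fun_bigcup => n1 //.
exact: measurable_counts.
Qed.

(** The cells [counts n0 n1] partition the sample space; splitting by [N0] first leaves the sum over
    [N1] inside, where the Poisson recursion will act. *)
Lemma integral_counts (g : T -> \bar R) :
  (forall n0 n1, measurable_fun (counts n0 n1) g) -> (forall w, 0 <= g w)%E ->
  (\int[P]_w g w = \sum_(0 <= n0 <oo) \sum_(0 <= n1 <oo)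
     \int[P]_(w in counts n0 n1) g w)%E.
Proof.
move=> mg g0; have mgT := measurable_fun_counts _ mg.
rewrite -{1}bigcup_N0 ge0_integral_bigcup//; last 2 first.
- by rewrite bigcup_N0.
- by move=> i j _ _ [w [/= <- <-]].
apply: eq_eseriesr => n0 _; rewrite -bigcup_counts ge0_integral_bigcup//.
- by move=> n1; exact: measurable_counts.
- by rewrite bigcup_counts; apply: measurable_funTS.
- by move=> i j _ _ [w [[/= _ <-] [/= _ <-]]].
Qed.

Lemma integral_FW_sum nk :
  (forall n0 n1, 0 <= FW_sum f0 f1 nk n0 n1) ->
  (\int[P]_w (FW_sum f0 f1 nk (N0 w) (N1 w))%:E =
   \sum_(0 <= n0 <oo) \sum_(0 <= n1 <oo)
     (FW_sum f0 f1 nk n0 n1 * pr P (counts n0 n1))%:E)%E.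
Proof.
move=> FW0.
have onc n0 n1 : {in counts n0 n1, cst (FW_sum f0 f1 nk n0 n1)%:E =1
    (fun w => (FW_sum f0 f1 nk (N0 w) (N1 w))%:E)}.
  by move=> w; rewrite inE => -[/= -> ->].
rewrite integral_counts//; last 2 first.
- move=> n0 n1; apply: eq_measurable_fun (onc n0 n1) _; exact: measurable_cst.
- by move=> w; rewrite lee_fin.
apply: eq_eseriesr => n0 _; apply: eq_eseriesr => n1 _.
rewrite -(eq_integral _ _ (onc n0 n1)) integral_cst; last exact: measurable_counts.
by rewrite EFinM EFin_pr//; exact: measurable_counts.
Qed.

Lemma bp_ratio_ge0 (s0 s1 : nat -> R) nk n0 n1 : 0 <= bp_ratio s0 s1 nk n0 n1.
Proof. by rewrite /bp_ratio; case: ifP => // _; rewrite divr_ge0. Qed.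

Lemma bp_ratioE nk n0 n1 w : (0 < n1)%N ->
  bp_ratio (fun i => S0 i w) (fun i => S1 i w) nk n0 n1 =
  n1%:R^-1 * \sum_(j < n1) \1_(inspected nk n0 n1 j) w.
Proof.
move=> n1_gt0; rewrite /bp_ratio eqn0Ngt n1_gt0 mulrC /bp_detected; congr (_ * _).
rewrite card_classical_set -sum1_card natr_sum big_mkcond/=.
apply: eq_bigr => j _; rewrite inE indicE.
set b := (_ < _)%N; have -> : (w \in inspected nk n0 n1 j) = b.
  by apply/idP/idP; rewrite inE.
by case: b.
Qed.

Lemma measurable_bp_ratio nk n0 n1 : measurable_fun setT (fun w =>
  (bp_ratio (fun i => S0 i w) (fun i => S1 i w) nk n0 n1)).
Proof.
case: n1 => [|n1]; first exact: measurable_cst.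
under eq_fun do rewrite bp_ratioE//.
apply: measurable_funM; first exact: measurable_cst.
apply: measurable_sum => j; apply: measurable_indic.
exact: measurable_inspected.
Qed.

(** On one cell the ratio is the average of the indicators of the [n1] inspection events, each
    bounded below by [pr_inspected_ge]. For [n1 = 0] both sides equal the probability of the
    cell. *)
Lemma integral_bp_ratio_ge nk n0 n1 :
  ((detection_ratio nk n0 n1 * pr P (counts n0 n1))%:E <=
   \int[P]_(w in counts n0 n1)
     (bp_ratio (fun i => S0 i w) (fun i => S1 i w) nk n0 n1)%:E)%E.
Proof.
have mc : measurable (counts n0 n1) by exact: measurable_counts.
case: n1 mc => [|n] mc.
  by rewrite /bp_ratio eqxx integral_cst// EFinM EFin_pr.
under eq_integral do rewrite bp_ratioE// EFinM -sumEFin.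
have mi (j : 'I_n.+1) : measurable_fun (counts n0 n.+1)
    (fun w => (\1_(inspected nk n0 n.+1 j) w : R)%:E).
  apply/measurable_EFinP; apply: measurable_indic; exact: measurable_inspected.
rewrite ge0_integralZl_EFin//; last 2 first.
- by move=> w _; apply: sume_ge0 => j _; rewrite lee_fin.
- exact: emeasurable_sum.
rewrite ge0_integral_sum//.
have mI (j : 'I_n.+1) : measurable (inspected nk n0 n.+1 j).
  exact: measurable_inspected.
rewrite (eq_bigr (fun j : 'I_n.+1 =>
    (pr P (counts n0 n.+1 `&` inspected nk n0 n.+1 j))%:E)); last first.
  by move=> j _; rewrite integral_indic// setIC EFin_pr//; exact: measurableI.
rewrite sumEFin -EFinM lee_fin ler_pdivlMl//.
apply: (@le_trans _ _ (\sum_(j < n.+1)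
  (pr P (counts n0 n.+1) * detection nk n0 n))).
  by rewrite sumr_const card_ord mulr_natl [_ * pr _ _]mulrC.
by apply: ler_sum => j _; exact: pr_inspected_ge.
Qed.

Lemma integral_bp_ratio nk :
  (\sum_(0 <= n0 <oo) \sum_(0 <= n1 <oo)
     (detection_ratio nk n0 n1 * pr P (counts n0 n1))%:E <=
   \int[P]_w (bp_ratio (fun i => S0 i w) (fun i => S1 i w)
                nk (N0 w) (N1 w))%:E)%E.
Proof.
have onc n0 n1 : {in counts n0 n1,
    (fun w => (bp_ratio (fun i => S0 i w) (fun i => S1 i w) nk n0 n1)%:E) =1
    (fun w => (bp_ratio (fun i => S0 i w) (fun i => S1 i w)
                 nk (N0 w) (N1 w))%:E)}.
  by move=> w; rewrite inE => -[/= -> ->].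
rewrite integral_counts//; last 2 first.
- move=> n0 n1; apply: eq_measurable_fun (onc n0 n1) _.
  apply/measurable_EFinP; apply: measurable_funTS; exact: measurable_bp_ratio.
- by move=> w; rewrite lee_fin bp_ratio_ge0.
have term_ge0 n0 n1 : (0 <= (detection_ratio nk n0 n1 * pr P (counts n0 n1))%:E)%E.
  by rewrite lee_fin mulr_ge0 ?detection_ratio_ge0 ?pr_ge0.
apply: lee_nneseries => [n0 _ _|n0 _]; first exact: nneseries_ge0.
apply: lee_nneseries => [//|n1 _].
by rewrite -(eq_integral _ _ (onc n0 n1)) integral_bp_ratio_ge.
Qed.

End independent_scores.

(** * Poisson weights and the final bound *)

Lemma poisson_massS (R : realType) (m : R) (n : nat) :
  poisson_mass m n.+1 * n.+1%:R = m * poisson_mass m n.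
Proof.
have nf : (n`!%:R : R) != 0 by rewrite pnatr_eq0 -lt0n fact_gt0.
have n1 : (n.+1%:R : R) != 0 by rewrite pnatr_eq0.
rewrite /poisson_mass factS natrM exprS.
move: (n.+1%:R : R) (n`!%:R : R) n1 nf => x y x0 y0.
by field; rewrite x0 y0.
Qed.

(* [E[N h(N)] = m E[h(N + 1)]] for [N] Poisson of mean [m], and [h(N + 1)] is at
   most [h(N)] for nonincreasing [h]. *)
Lemma nneseries_poisson_le (R : realType) (m : R) (p h g : nat -> R) : 0 < m ->
  (forall n, p n.+1 * n.+1%:R = m * p n) -> (forall n, 0 <= p n) ->
  (forall n, 0 <= h n) -> (forall n, h n.+1 <= h n) ->
  (forall n, 0 <= g n <= n%:R * h n) ->
  (m^-1%:E * \sum_(0 <= n <oo) (g n * p n)%:E <=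
   \sum_(0 <= n <oo) (h n * p n)%:E)%E.
Proof.
move=> m0 pS p0 h0 hS gh.
have g0 n : 0 <= g n by have /andP[] := gh n.
rewrite -nneseriesZl; last by move=> n _; rewrite lee_fin mulr_ge0.
pose a n := (m^-1 * (n%:R * h n * p n))%:E.
have a0 n : (0 <= a n)%E by rewrite lee_fin !mulr_ge0 ?invr_ge0 ?(ltW m0).
apply: (@le_trans _ _ (\sum_(0 <= n <oo) a n)%E).
  apply: lee_nneseries => [n _ _|n _].
    by rewrite -EFinM lee_fin !mulr_ge0 ?invr_ge0 ?(ltW m0).
  rewrite -EFinM lee_fin ler_wpM2l ?invr_ge0 ?(ltW m0)// ler_wpM2r//.
  by have /andP[] := gh n.
(* The factor [n] kills the term of index 0, so the index can be shifted by one. *)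
rewrite nneseries_recl// {1}/a !mul0r mulr0 add0e -nneseries_addn//.
apply: lee_nneseries => [n _ _|n _]; first exact: a0.
rewrite addn1 /a lee_fin.
rewrite (_ : _ * (_ * _ * _) = h n.+1 * (m^-1 * (p n.+1 * n.+1%:R))); last by ring.
by rewrite pS mulKf ?gt_eqF// ler_wpM2r.
Qed.

Theorem theorem6 (R : realType) (d : measure_display) (T : measurableType d)
    (P : probability T R)
    (beta tau k : R) (lam f0 f1 : R -> R)
    (N0 N1 : T -> nat) (S0 S1 : nat -> T -> R) :
  0 < beta -> beta < 1 / 2 ->
  0 < tau ->
  continuous lam -> (forall t, 0 <= lam t) ->
  0 <= k <= 1 ->
  (* score densities on [0,1] *)
  (forall x, 0 <= x <= 1 -> 0 <= f0 x) ->
  (forall x, 0 <= x <= 1 -> 0 <= f1 x) ->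
  (@lebesgue_measure R).-integrable `[0, 1] (EFin \o f0) ->
  (@lebesgue_measure R).-integrable `[0, 1] (EFin \o f1) ->
  \int[@lebesgue_measure R]_(x in `[0, 1]) f0 x = 1 ->
  \int[@lebesgue_measure R]_(x in `[0, 1]) f1 x = 1 ->
  (* measurability of the random variables *)
  (forall n, measurable (N0 @^-1` [set n])) ->
  (forall n, measurable (N1 @^-1` [set n])) ->
  (forall i, measurable_fun setT (S0 i)) ->
  (forall i, measurable_fun setT (S1 i)) ->
  (* N0(tau), N1(tau): Poisson counts of the thinned NHPPs *)
  (forall n, pr P (N0 @^-1` [set n])
             = poisson_mass ((1 - beta) * cum_intensity lam tau) n) ->
  (forall n, pr P (N1 @^-1` [set n])
             = poisson_mass (beta * cum_intensity lam tau) n) ->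
  (* score laws: densities f0 (non-fraudulent), f1 (fraudulent) on [0,1] *)
  (forall i B, measurable B ->
     pr P (S0 i @^-1` B) = \int[@lebesgue_measure R]_(x in B `&` `[0, 1]) f0 x) ->
  (forall i B, measurable B ->
     pr P (S1 i @^-1` B) = \int[@lebesgue_measure R]_(x in B `&` `[0, 1]) f1 x) ->
  (* mutual independence of N0, N1, (S0 i)_i, (S1 j)_j *)
  (forall (n0 n1 : nat) (I J : seq nat) (A B : nat -> set R),
     uniq I -> uniq J ->
     (forall i, measurable (A i)) -> (forall j, measurable (B j)) ->
     pr P [set w | [/\ N0 w = n0, N1 w = n1,
                      (forall i, i \in I -> A i (S0 i w)) &
                      (forall j, j \in J -> B j (S1 j w))]]
     = pr P (N0 @^-1` [set n0]) * pr P (N1 @^-1` [set n1])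
       * \prod_(i <- I) pr P (S0 i @^-1` A i)
       * \prod_(j <- J) pr P (S1 j @^-1` B j)) ->
  let Lam := cum_intensity lam tau in
  let nk := capacity_nk k Lam in
  (((beta * Lam)^-1)%:E
     * \int[P]_w (FW_sum f0 f1 nk (N0 w) (N1 w))%:E
   <= \int[P]_w (bp_ratio (fun i => S0 i w) (fun j => S1 j w) nk (N0 w) (N1 w))%:E)%E.
Proof.
move=> beta0 beta2 tau0 _ lam0 _ f0_ge0 f1_ge0 f0_int f1_int f0_1 f1_1.
move=> mN0 mN1 mS0 mS1 N0_law N1_law S0_law S1_law indep; cbv zeta.
set Lam := cum_intensity lam tau; set nk := capacity_nk k Lam.
have Lam0 : 0 <= Lam by apply: Rintegral_ge0 => t _.
have ratio_ge0 : (0 <= \int[P]_w (bp_ratio (fun i => S0 i w) (fun j => S1 j w)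
    nk (N0 w) (N1 w))%:E)%E.
  by apply: integral_ge0 => w _; rewrite lee_fin bp_ratio_ge0.
have FW0 n0 n1 : 0 <= FW_sum f0 f1 nk n0 n1.
  by apply: FW_sum_ge0.
(* If [Lam] is 0, the inverse of [beta * Lam] is 0 by convention and the left-hand side vanishes. *)
move: Lam0; rewrite le_eqVlt => /predU1P[<-|Lam0].
  by rewrite mulr0 invr0 mul0e.
have m0 : 0 < beta * Lam by rewrite mulr_gt0.
apply: le_trans (integral_bp_ratio _ _ _ _ _ _ _ _ _ _ f0_ge0 f1_ge0 f0_int
  f1_int mN0 mN1 mS0 mS1 S0_law S1_law indep f0_1 f1_1 nk).
rewrite (integral_FW_sum _ _ _ _ _ _ _ _ mN0 mN1 nk FW0)//.
have c0 n0 n1 : 0 <= pr P (counts _ _ N0 N1 n0 n1) by exact: pr_ge0.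
rewrite -nneseriesZl; last first.
  by move=> n0 _; apply: nneseries_ge0 => n1 _ _; rewrite lee_fin mulr_ge0.
apply: lee_nneseries => [n0 _ _|n0 _].
  rewrite mule_ge0 ?lee_fin ?invr_ge0 ?(ltW m0)//.
  by apply: nneseries_ge0 => n1 _ _; rewrite lee_fin mulr_ge0.
(* For fixed [n0], the weight of a cell is a constant times a Poisson weight in [n1], so it obeys
   the same recursion. *)
apply: nneseries_poisson_le => //.
- move=> n1; rewrite !(pr_counts _ _ _ _ _ _ _ _ indep) !N1_law -mulrA.
  by rewrite poisson_massS mulrCA.
- by move=> n1; exact: detection_ratio_ge0.
- by move=> n1; exact: detection_ratioS_le.
- by move=> n1; rewrite FW0 FW_sum_le_ratio.
Qed.
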